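(* Let $\mathcal X\subseteq\mathbb R^n$ and $\mathcal Y\subseteq\mathbb R^m$ be closed convex sets, let $f:\mathcal X\to\mathbb R$ and $g:\mathcal Y\to\mathbb R$ be proper convex but not necessarily smooth functions, let $A\in\mathbb R^{m\times n}$ be a given matrix, and put $\mathcal L(x,y)=f(x)-y^TAx-g(y)$. Let $\alpha\in[0,1]$ and let $r>0$, $s>0$ satisfy $$r\cdot s>(1-\alpha+\alpha^2)\,\rho(A^TA).$$ Then the sequence $\{u^k\}=\{(x^k,y^k)\}$ generated by the generalized CP-PPA converges to a solution point of the saddle point problem $$\min_{x\in\mathcal X}\max_{y\in\mathcal Y}\mathcal L(x,y).$$
   Context: $\rho(A^TA)$ denotes the largest eigenvalue (spectral radius) of $A^TA$; $\|\cdot\|$ is the Euclidean norm. A solution point of the saddle point problem is a pair $(x^*,y^* )\in\mathcal X\times\mathcal Y$ with $\mathcal L(x^*,y)\le\mathcal L(x^*,y^* )\le\mathcal L(x,y^* )$ for all $x\in\mathcal X$, $y\in\mathcal Y$. The generalized CP-PPA (with parameters $r,s>0$, $\alpha\in[0,1]$) generates, for $k=0,1,2,\dots$, from $u^k=(x^k,y^k)$ the next iterate $u^{k+1}=(x^{k+1},y^{k+1})$ by $$x^{k+1}=\arg\min\{\mathcal L(x,y^k)+\tfrac r2\|x-x^k\|^2: x\in\mathcal X\},$$ $$\bar x^{k+1}=x^{k+1}+\alpha(x^{k+1}-x^k),$$ $$\bar y^{k+1}=\arg\max\{\mathcal L(\bar x^{k+1},y)-\tfrac s2\|y-y^k\|^2: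 y\in\mathcal Y\},$$ $$y^{k+1}=\bar y^{k+1}-(1-\alpha)\tfrac1s A(x^{k+1}-x^k).$$ In the $\bar y^{k+1}$ step the term $f(\bar x^{k+1})$ does not depend on $y$ and plays no role, i.e. one maximizes $-y^TA\bar x^{k+1}-g(y)-\frac s2\|y-y^k\|^2$ over $y\in\mathcal Y$.
   Formalization: The formal theorem additionally assumes that the saddle point problem has a solution point and that f and g, extended by +∞ outside X and Y, are lower semicontinuous (closed); without either assumption the claim is false. *)

(* Defs.v *)
From HB Require Import structures.
From mathcomp Require Import all_boot all_order all_algebra.
From mathcomp Require Import all_classical all_reals all_analysis.

Set Implicit Arguments.
Unset Strict Implicit.
Unset Printing Implicit Defensive.

Import Order.TTheory GRing.Theory Num.Theory.
Import numFieldNormedType.Exports.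

Local Open Scope classical_set_scope.
Local Open Scope ring_scope.

(* The canonical norm `|v| on matrices is the sup norm, hence a separate
   definition; the topology on 'cV[R]_n is the usual one in either case. *)
Definition enorm (R : realType) (n : nat) (v : 'cV[R]_n) : R :=
  Num.sqrt (\sum_(i < n) v i ord0 ^+ 2).

(* Meant for symmetric matrices, whose spectrum is real.  The set is then
   finite, and nonempty as soon as 0 < n; for n = 0 the value is sup set0 = 0. *)
Definition largest_eigenvalue (R : realType) (n : nat) (M : 'M[R]_n) : R :=
  sup [set a : R | eigenvalue M a].

(* The extension of f by +oo outside D: D is the effective domain of f, and the
   values of the total function f outside D are irrelevant. *)
Definition extend_pinfty (R : realType) (n : nat) (D : set 'cV[R]_n)
    (f : 'cV[R]_n -> R) : 'cV[R]_n -> \bar R :=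
  fun x => if x \in D then (f x)%:E else +oo%E.

(* A real-valued function on D is proper exactly when D is nonempty. *)
Definition proper_convex (R : realType) (n : nat) (D : set 'cV[R]_n)
    (f : 'cV[R]_n -> R) : Prop :=
  D !=set0 /\ convex_function D f.

Definition is_argmin (R : realType) (T : Type) (D : set T) (phi : T -> R)
    (x : T) : Prop :=
  D x /\ forall z, D z -> phi x <= phi z.

Definition is_argmax (R : realType) (T : Type) (D : set T) (phi : T -> R)
    (x : T) : Prop :=
  D x /\ forall z, D z -> phi z <= phi x.

Section SaddlePoint.
Context {R : realType} {n m : nat}.
Variables (X : set 'cV[R]_n) (Y : set 'cV[R]_m).
Variables (f : 'cV[R]_n -> R) (g : 'cV[R]_m -> R) (A : 'M[R]_(m, n)).

(* y^T A x as a scalar *)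
Definition coupling (x : 'cV[R]_n) (y : 'cV[R]_m) : R :=
  (y^T *m A *m x) ord0 ord0.

Definition lagrangian (x : 'cV[R]_n) (y : 'cV[R]_m) : R :=
  f x - coupling x y - g y.

Definition saddle_point (u : 'cV[R]_n * 'cV[R]_m) : Prop :=
  [/\ X u.1, Y u.2 &
      forall x y, X x -> Y y ->
        lagrangian u.1 y <= lagrangian u.1 u.2 /\
        lagrangian u.1 u.2 <= lagrangian x u.2].

(* One iteration u = (x^k, y^k) |-> u' = (x^{k+1}, y^{k+1}).  The extrapolated
   point xbar may leave X, so f xbar, a constant in the y-subproblem, is
   dropped there.  Similarly u.2 may leave Y, but g u.2 is a constant in the
   x-subproblem and has no influence on the minimizer. *)
Definition gcppa_step (alpha r s : R) (u u' : 'cV[R]_n * 'cV[R]_m) : Prop :=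
  let xbar := u'.1 + alpha *: (u'.1 - u.1) in
  exists ybar : 'cV[R]_m,
    [/\ is_argmin X
          (fun x => lagrangian x u.2 + r / 2 * enorm (x - u.1) ^+ 2) u'.1,
        is_argmax Y
          (fun y => - coupling xbar y - g y - s / 2 * enorm (y - u.2) ^+ 2)
          ybar &
        u'.2 = ybar - ((1 - alpha) * s^-1) *: (A *m (u'.1 - u.1))].

Definition gcppa_sequence (alpha r s : R)
    (u : nat -> 'cV[R]_n * 'cV[R]_m) : Prop :=
  forall k, gcppa_step alpha r s (u k) (u k.+1).

End SaddlePoint.

(* Main.v *)
(* Write p = x^k - x^{k+1} and q = y^k - ybar^{k+1}.  The optimality conditions
   of the two subproblems, tested at a saddle point w, add up to
     |u^{k+1} - w|_H^2 + |(p, q)|_G^2 <= |u^k - w|_H^2,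
   where H = [[r + ((1-alpha)/s) A^T A, A^T], [A, s]] and
   G = [[r + (alpha(1-alpha)/s) A^T A, A^T], [A, s]].  Their Schur complements
   are positive definite when r s exceeds alpha rho and (1 - alpha + alpha^2) rho
   respectively, and alpha <= 1 - alpha + alpha^2.  So the iterates are bounded
   and (p, q) tends to 0; a cluster point is a saddle point by lower
   semicontinuity, and the inequality with w equal to this point upgrades
   subsequential to full convergence. *)
Require Import Defs.
From HB Require Import structures.
From mathcomp Require Import all_boot all_order all_algebra.
From mathcomp Require Import all_classical all_reals all_analysis.
From mathcomp Require Import ring lra.

Set Implicit Arguments.
Unset Strict Implicit.
Unset Printing Implicit Defensive.

Import Order.TTheory GRing.Theory Num.Theory.
Import numFieldNormedType.Exports.

Local Open Scope classical_set_scope.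
Local Open Scope ring_scope.

(** * Euclidean inner product on column vectors, and limits taken through it *)

Section Dot.
Context {R : realType}.

Definition dot n (u v : 'cV[R]_n) : R := (u^T *m v) ord0 ord0.

Lemma dotE n (u v : 'cV[R]_n) : dot u v = \sum_i u i ord0 * v i ord0.
Proof. by rewrite /dot mxE; apply: eq_bigr => i _; rewrite mxE. Qed.

Lemma dotC n (u v : 'cV[R]_n) : dot u v = dot v u.
Proof. by rewrite !dotE; apply: eq_bigr => i _; rewrite mulrC. Qed.

Lemma dotDr n (u v w : 'cV[R]_n) : dot u (v + w) = dot u v + dot u w.
Proof. by rewrite /dot mulmxDr mxE. Qed.

Lemma dotDl n (u v w : 'cV[R]_n) : dot (u + v) w = dot u w + dot v w.
Proof. by rewrite dotC dotDr !(dotC w). Qed.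

Lemma dotZr n (a : R) (u v : 'cV[R]_n) : dot u (a *: v) = a * dot u v.
Proof. by rewrite /dot -scalemxAr mxE. Qed.

Lemma dotZl n (a : R) (u v : 'cV[R]_n) : dot (a *: u) v = a * dot u v.
Proof. by rewrite dotC dotZr dotC. Qed.

Lemma dotNr n (u v : 'cV[R]_n) : dot u (- v) = - dot u v.
Proof. by rewrite -scaleN1r dotZr mulN1r. Qed.

Lemma dotNl n (u v : 'cV[R]_n) : dot (- u) v = - dot u v.
Proof. by rewrite dotC dotNr dotC. Qed.

Lemma dot_mulmxl m n (A : 'M[R]_(m, n)) (x : 'cV_n) (y : 'cV_m) :
  dot (A *m x) y = dot x (A^T *m y).
Proof. by rewrite /dot trmx_mul mulmxA. Qed.

Lemma dot_ge0 n (u : 'cV[R]_n) : 0 <= dot u u.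
Proof. by rewrite dotE sumr_ge0 // => i _; rewrite -expr2 sqr_ge0. Qed.

Lemma sqr_coord_le_dot n (u : 'cV[R]_n) i : u i ord0 ^+ 2 <= dot u u.
Proof.
rewrite dotE (bigD1 i) //= -expr2 lerDl sumr_ge0 // => j _.
by rewrite -expr2 sqr_ge0.
Qed.

Lemma dot_eq0 n (u : 'cV[R]_n) : (dot u u == 0) = (u == 0).
Proof.
apply/idP/eqP => [/eqP u0|->]; last by rewrite /dot mulmx0 mxE.
apply/colP => i; rewrite mxE; apply/eqP; rewrite -sqrf_eq0 eq_le sqr_ge0 andbT.
by rewrite -u0 sqr_coord_le_dot.
Qed.

Lemma sqr_enorm n (u : 'cV[R]_n) : enorm u ^+ 2 = dot u u.
Proof.
have -> : enorm u = Num.sqrt (dot u u).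
  by rewrite dotE; congr Num.sqrt; apply: eq_bigr => i _; rewrite expr2.
by rewrite sqr_sqrtr // dot_ge0.
Qed.

Lemma couplingE n m (A : 'M[R]_(m, n)) x y :
  coupling A x y = dot y (A *m x).
Proof. by rewrite /coupling /dot mulmxA. Qed.

Section Convergence.
Context {T : Type} {F : set_system T} {FF : Filter F}.

Lemma cvg_cV n (v : T -> 'cV[R]_n) (w : 'cV[R]_n) :
  (forall i, v t i ord0 @[t --> F] --> w i ord0) -> v @ F --> w.
Proof.
move=> vw; apply/cvgrPdist_le => e e0; near=> t.
rewrite [leLHS]/Num.Def.normr/= mx_normrE (bigmax_le _ (ltW e0))// => -[i j] _.
rewrite !mxE !ord1 /=.
move: i; near: t; apply: filter_forall => i.
exact: ((cvgrPdist_le _ _).1 (vw i)).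
Unshelve. all: by end_near. Qed.

Lemma cvg_coord n (v : T -> 'cV[R]_n) (w : 'cV[R]_n) i :
  v @ F --> w -> v t i ord0 @[t --> F] --> w i ord0.
Proof.
move=> vw.
exact: (@cvg_comp _ _ _ v (fun u : 'cV[R]_n => u i ord0) F (nbhs w) _ vw
  (@coord_continuous R n 1 i ord0 w)).
Qed.

Lemma cvg_dot n (u v : T -> 'cV[R]_n) (a b : 'cV[R]_n) :
  u @ F --> a -> v @ F --> b -> dot (u t) (v t) @[t --> F] --> dot a b.
Proof.
move=> ua vb; rewrite dotE.
under eq_cvg do rewrite dotE.
apply: cvg_big => [|i _]; first exact: add_continuous.
by apply: cvgM; apply: cvg_coord.
Qed.

Lemma cvg_mulmx m n (A : 'M[R]_(m, n)) (v : T -> 'cV[R]_n) (w : 'cV[R]_n) :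
  v @ F --> w -> A *m v t @[t --> F] --> A *m w.
Proof.
move=> vw; apply: cvg_cV => i; rewrite mxE.
under eq_cvg do rewrite mxE.
apply: cvg_big => [|j _]; first exact: add_continuous.
by apply: cvgM; [exact: cvg_cst|exact: cvg_coord].
Qed.

Lemma cvg_dot0 n (v : T -> 'cV[R]_n) :
  dot (v t) (v t) @[t --> F] --> (0 : R) -> v @ F --> (0 : 'cV[R]_n).
Proof.
move=> v0; apply: cvg_cV => i; rewrite mxE; apply: norm_cvg0.
apply: (@squeeze_cvgr _ _ _ _ (cst 0) (fun t => Num.sqrt (dot (v t) (v t)))).
- apply: nearW => t; rewrite normr_ge0 /= -sqrtr_sqr.
  by rewrite ler_wsqrtr // sqr_coord_le_dot.
- exact: cvg_cst.
- rewrite -[X in _ --> X]sqrtr0.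
  exact: (@cvg_comp _ _ _ (fun t => dot (v t) (v t)) Num.sqrt F (nbhs (0 : R))
    _ v0 (@sqrt_continuous R 0)).
Qed.

End Convergence.

End Dot.

(** * Convergent subsequences of bounded sequences of vectors *)

Lemma increasing_seq_cvg_infty (h : nat -> nat) :
  increasing_seq h -> h @ \oo --> \oo.
Proof.
move=> h_incr P [N _ NP]; exists N => // k /= Nk; apply: NP => /=.
apply: leq_trans Nk _.
elim: k => // k IHk; apply: leq_ltn_trans IHk _.
by move/increasing_seqP : h_incr; apply.
Qed.

(** Induction on the number of coordinates: a subsequence that works for all coordinates but the
    first is refined by Bolzano-Weierstrass applied to the first one. *)
Lemma bounded_coord_cvg_subseq (R : realType) d (w : nat -> 'I_d -> R) (M : R) :
  (forall k i, `|w k i| <= M) ->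
  exists2 h : nat -> nat, increasing_seq h &
    exists l : 'I_d -> R, forall i, w (h k) i @[k --> \oo] --> l i.
Proof.
elim: d w => [|d IHd] w wM.
  by exists id => //; exists (fun=> 0) => -[].
have [h h_incr [l wl]] :=
  IHd (fun k i => w k (lift ord0 i)) (fun k i => wM _ _).
have [|h' h'_incr /cvg_ex[/= l' wl']] :=
    @bolzano_weierstrass R (fun k => w (h k) ord0).
  exists M; split; first exact: num_real.
  by move=> N MN k _ /=; apply: le_trans (wM _ _) (ltW MN).
exists (h \o h').
  by move=> i j; exact: etrans (h_incr _ _) (h'_incr _ _).
exists (fun i => if unlift ord0 i is Some j then l j else l') => i.
case: unliftP => [j ->|->]; last exact: wl'.
exact: (@cvg_comp _ _ _ h' (fun k => w (h k) (lift ord0 j)) _ _ _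
  (increasing_seq_cvg_infty h'_incr) (wl j)).
Qed.

Lemma bounded_cV_cvg_subseq (R : realType) n (v : nat -> 'cV[R]_n) (M : R) :
  (forall k, dot (v k) (v k) <= M) ->
  exists2 h : nat -> nat, increasing_seq h &
    exists l : 'cV[R]_n, v (h k) @[k --> \oo] --> l.
Proof.
move=> vM.
have [|h h_incr [l vl]] :=
    @bounded_coord_cvg_subseq R n (fun k i => v k i ord0) (Num.sqrt M).
  move=> k i; rewrite -sqrtr_sqr ler_wsqrtr //.
  exact: le_trans (sqr_coord_le_dot _ _) (vM k).
exists h => //; exists (\col_i l i); apply: cvg_cV => i.
by rewrite mxE; exact: vl.
Qed.

(** Divide by [t] and let [t] tend to 0. This turns minimality along a segment into a first-order
    condition. *)
Lemma linear_term_ge0 (R : realFieldType) (a b : R) :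
  (forall t : R, 0 < t -> t <= 1 -> 0 <= t * b + t ^+ 2 * a) -> 0 <= b.
Proof.
move=> tba; rewrite leNgt; apply/negP => b_lt0.
have c_gt0 : 0 < `|a| - b by rewrite ltr_wpDl // oppr_gt0.
(* If [b < 0], this [t] gives [t * a <= - b / 2], hence [b + t * a <= b / 2 < 0]. *)
pose t := - b / (2 * (`|a| - b)).
have t_gt0 : 0 < t by rewrite divr_gt0 ?oppr_gt0 ?mulr_gt0.
have t_le1 : t <= 1.
  rewrite ler_pdivrMr ?mulr_gt0 // mul1r.
  by have := normr_ge0 a; lra.
have := tba t t_gt0 t_le1.
rewrite expr2 -mulrA -mulrDr pmulr_rge0 // leNgt => /negP; apply.
have ta : t * a <= t * (`|a| - b).
  by rewrite ler_pM2l //; have := ler_norm a; lra.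
have : t * (`|a| - b) = - b / 2.
  by rewrite /t; field; rewrite gt_eqF.
lra.
Qed.

(** * The largest eigenvalue of a Gram matrix bounds its quadratic form *)

Section Spectral.
Context {R : realType}.

(** Rayleigh quotient: [l] is the maximum of |Ax|^2 on the unit sphere, attained at some [c] by
    compactness. The form l|x|^2 - |Ax|^2 is nonnegative and vanishes at [c], so its gradient
    vanishes there, which says A^T A c = l c. *)
Lemma max_dot_eigenvalue n m (A : 'M[R]_(m, n.+1)) :
  exists2 l, 0 <= l /\ eigenvalue (A^T *m A) l &
    forall x, dot (A *m x) (A *m x) <= l * dot x x.
Proof.
(* The sphere consists of row vectors, the format of both the extreme value theorem and
   [eigenvalue]. *)
pose S := [set w : 'rV[R]_n.+1 | dot w^T w^T = 1].
have cvgT (w : 'rV[R]_n.+1) : v^T @[v --> w] --> w^T.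
  apply: (@cvg_cV _ _ (nbhs w) _ _ (fun v : 'rV[R]_n.+1 => v^T)) => i.
  by rewrite mxE; under eq_cvg do rewrite mxE; exact: coord_continuous.
have cS : compact S.
  apply: bounded_closed_compact.
    exists 1; split => // M M1 w /= w1.
    apply: le_trans (ltW M1).
    rewrite [leLHS]/Num.Def.normr/= mx_normrE bigmax_le // => -[i j] _ /=.
    rewrite ord1 -(@ler_pXn2r _ 2) ?nnegrE // expr1n.
    rewrite real_normK ?num_real // -w1.
    by have := sqr_coord_le_dot w^T j; rewrite mxE.
  rewrite (_ : S = (fun w : 'rV[R]_n.+1 => dot w^T w^T) @^-1` [set 1]) //.
  apply: preimage_closed; last exact: closed_eq.
  move=> w _.
  by apply: (@cvg_dot _ _ (nbhs w) _ _ trmx trmx); exact: cvgT.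
have [||c] := @EVT_max_rV R _ (fun w => dot (A *m w^T) (A *m w^T)) S _ cS.
- exists (delta_mx ord0 ord0); rewrite /S /= dotE (bigD1 ord0) //= big1.
    by rewrite !mxE !eqxx mulr1 addr0.
  by move=> i /negbTE i0; rewrite !mxE i0 andbF mul0r.
- apply: continuous_subspaceT => w.
  pose AT (v : 'rV[R]_n.+1) := A *m v^T.
  by apply: (@cvg_dot _ _ (nbhs w) _ _ AT AT); apply: cvg_mulmx; exact: cvgT.
rewrite inE /S /= => c1 c_max.
set l := dot (A *m c^T) (A *m c^T) in c_max.
have lP x : dot (A *m x) (A *m x) <= l * dot x x.
  have [->|x0] := eqVneq x 0; first by rewrite mulmx0 /dot !mulmx0 mxE mulr0.
  have xx_gt0 : 0 < dot x x by rewrite lt_neqAle eq_sym dot_eq0 x0 dot_ge0.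
  pose t := (Num.sqrt (dot x x))^-1.
  have t2 : t * t * dot x x = 1.
    by rewrite -expr2 exprVn sqr_sqrtr ?dot_ge0 // mulVf // gt_eqF.
  have t2_gt0 : 0 < t * t by rewrite mulr_gt0 ?invr_gt0 ?sqrtr_gt0.
  have := c_max (t *: x)^T; rewrite inE /S /= trmxK dotZl dotZr mulrA t2.
  move=> /(_ erefl).
  rewrite -scalemxAr dotZl dotZr mulrA => le_l.
  by rewrite -(ler_pM2l t2_gt0) (mulrCA _ l) t2 mulr1.
exists l => //; split; first exact: dot_ge0.
(* First-order optimality of c, perturbed in the direction of e. *)
pose e := A^T *m (A *m c^T) - l *: c^T.
have e0 : e = 0.
  apply/eqP; rewrite -dot_eq0 eq_le dot_ge0 andbT -oppr_ge0.
  suff : 0 <= - (2 * dot e e) by rewrite -mulrN pmulr_rge0.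
  apply: (@linear_term_ge0 _ (l * dot e e - dot (A *m e) (A *m e))) => t _ _.
  have eE : dot e e = dot (A *m c^T) (A *m e) - l * dot c^T e.
    by rewrite {1}/e dotDl dotNl dotZl dot_mulmxl trmxK.
  clearbody e; have := lP (c^T + t *: e).
  rewrite mulmxDr -scalemxAr !(dotDl, dotDr, dotZl, dotZr) c1 -/l.
  rewrite (dotC (A *m e) (A *m c^T)) (dotC e c^T).
  by rewrite eE; lra.
apply/eigenvalueP; exists c.
  have /(congr1 trmx) : A^T *m (A *m c^T) = l *: c^T.
    by apply/eqP; rewrite -subr_eq0 -/e e0.
  by rewrite linearZ /= !trmx_mul !trmxK mulmxA.
by apply/eqP => c0; move: c1; rewrite c0 trmx0 /dot mulmx0 mxE => /eqP;
  rewrite eq_sym oner_eq0.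
Qed.

Lemma largest_eigenvalue_gram n m (A : 'M[R]_(m, n)) :
  0 <= largest_eigenvalue (A^T *m A) /\
  forall x, dot (A *m x) (A *m x) <= largest_eigenvalue (A^T *m A) * dot x x.
Proof.
case: n A => [|n] A.
  (* In dimension 0 there is no nonzero vector, so the spectrum is empty and its [sup] is 0 by
     convention. *)
  have -> : largest_eigenvalue (A^T *m A) = 0.
    rewrite /largest_eigenvalue (_ : mkset _ = set0) ?sup0 //.
    apply/seteqP; split => // a /= /eigenvalueP[v _].
    by rewrite (thinmx0 v) eqxx.
  by split => // x; rewrite (flatmx0 x) mulmx0 /dot mulmx0 mxE mul0r.
have [l [l_ge0 l_eig] lP] := max_dot_eigenvalue A.
have l_le : l <= largest_eigenvalue (A^T *m A).
  (* The supremum is meaningful because [l] bounds the spectrum: an eigenvector v for a satisfies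
     |Av|^2 = a|v|^2. *)
  apply: ub_le_sup => //; exists l => a /= /eigenvalueP[v va v0].
  have wa : A^T *m (A *m v^T) = a *: v^T.
    by rewrite -linearZ /= -va !trmx_mul trmxK mulmxA.
  have vv_gt0 : 0 < dot v^T v^T.
    by rewrite lt_neqAle eq_sym dot_eq0 trmx_eq0 v0 dot_ge0.
  by have := lP v^T; rewrite dot_mulmxl wa dotZr ler_pM2r.
split; first exact: le_trans l_le.
by move=> x; apply: le_trans (lP x) _; rewrite ler_wpM2r // dot_ge0.
Qed.

End Spectral.

(** * Optimality conditions of proximal subproblems, and lower semicontinuity *)

Section Minimization.
Context {R : realType} {n : nat} (D : set 'cV[R]_n).

(** Compare [z0] with z0 + t(z - z0), bound [h] there by convexity, and keep the part that is linear
    in t. The term [dot c z] will carry the coupling of the two variables. *)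
Lemma proximal_variational_inequality (h : 'cV[R]_n -> R) (c w z0 : 'cV[R]_n)
    (k : R) :
  convex_set D -> convex_function D h ->
  is_argmin D (fun z => h z + dot c z + k / 2 * dot (z - w) (z - w)) z0 ->
  forall z, D z ->
    h z0 <= h z + dot c (z - z0) + k * dot (z - z0) (z0 - w).
Proof.
move=> Dconv hconv [Dz0 z0_min] z Dz; rewrite -subr_ge0.
apply: (@linear_term_ge0 _ (k / 2 * dot (z - z0) (z - z0))) => t t_gt0 t_le1.
pose T := Itv01 (ltW t_gt0) t_le1.
have := Dconv z z0 T (mem_set Dz) (mem_set Dz0); rewrite inE => Dt.
have := hconv T z z0 (mem_set Dz) (mem_set Dz0).
have := z0_min _ Dt.
have tE : conv T (z : convex_lmodType 'cV[R]_n) z0 = z0 + t *: (z - z0).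
  rewrite /conv /= scalerBr scalerBl scale1r.
  by rewrite addrCA addrA.
rewrite tE convRE /=.
have -> : z0 + t *: (z - z0) - w = (z0 - w) + t *: (z - z0) by rewrite addrAC.
move: (z - z0) (z0 - w) => d e.
rewrite !(dotDl, dotDr, dotZl, dotZr) (dotC e d) /unstable.onem.
by set ht := h _; lra.
Qed.

(** If l < h z, a value a strictly between them is exceeded by [h] on [D] near z, hence eventually
    by [e], which contradicts the limit l. *)
Lemma lsc_extend_limit (h : 'cV[R]_n -> R) (v : nat -> 'cV[R]_n)
    (z : 'cV[R]_n) (e : nat -> R) (l : R) :
  closed D -> lower_semicontinuous (extend_pinfty D h) ->
  (forall k, D (v k)) -> v @ \oo --> z ->
  (forall k, h (v k) <= e k) -> e @ \oo --> l ->
  h z <= l.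
Proof.
move=> Dcl lsc Dv vz hv el.
have Dz : D z by apply: (@closed_cvg _ _ \oo _ v D Dcl _ _ vz); exact: nearW.
rewrite leNgt; apply/negP => l_lt.
pose a := (l + h z) / 2.
have [la ah] : l < a /\ a < h z by rewrite /a; split; lra.
have [|V Vz Va] := lsc z a; first by rewrite /extend_pinfty mem_set // lte_fin.
suff : a <= l by rewrite leNgt la.
apply: (cvgr_to_ge el); near=> k.
apply: le_trans (hv k); apply: ltW.
have : V (v k) by near: k; exact: vz.
by move=> /Va; rewrite /extend_pinfty mem_set // lte_fin.
Unshelve. all: by end_near. Qed.

End Minimization.

(** * The quadratic forms that measure the progress of the iteration *)

Section QuadraticForm.
Context {R : realType} {n m : nat}.
Implicit Types (A : 'M[R]_(m, n)) (p : 'cV[R]_n) (q : 'cV[R]_m).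

(* The quadratic form of [[r + (t/s) A^T A, A^T], [A, s]]; its Schur complement
   is r - ((1 - t)/s) A^T A. *)
Definition primal_dual_form A (r s t : R) p q : R :=
  r * dot p p + t / s * dot (A *m p) (A *m p) + 2 * dot (A *m p) q
  + s * dot q q.

(** Completing the square, s times the form is c|p|^2 + (1 - t)(l|p|^2 - |Ap|^2) + |Ap + sq|^2 with
    c = rs - (1 - t)l > 0. Control of |q|^2 comes from s^2|q|^2 <= 2|Ap + sq|^2 + 2|Ap|^2. *)
Lemma primal_dual_form_coercive A (r s t : R) :
  0 < s -> t <= 1 -> (1 - t) * largest_eigenvalue (A^T *m A) < r * s ->
  exists2 d, 0 < d & forall p q,
    d * (dot p p + dot q q) <= primal_dual_form A r s t p q.
Proof.
have [] := largest_eigenvalue_gram A.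
set l := largest_eigenvalue _ => l_ge0 lP s_gt0 t_le1 rs_large.
pose c := r * s - (1 - t) * l.
have c_gt0 : 0 < c by rewrite subr_gt0.
have c2l_gt0 : 0 < c + 2 * l by rewrite ltr_wpDr // mulr_ge0.
(* Small enough that 2e <= 1 and 2el <= c/2: the bound on e s^2|q|^2 then costs at most the whole
   square and half of c|p|^2. *)
pose e := c / (2 * (c + 2 * l)).
have e_gt0 : 0 < e by rewrite divr_gt0 // mulr_gt0.
have e_le : 2 * e <= 1.
  rewrite /e mulrA ler_pdivrMr ?mulr_gt0 //; lra.
have el_le : 2 * e * l <= c / 2.
  have -> : 2 * e * l = c / 2 - c ^+ 2 / (2 * (c + 2 * l)).
    by rewrite /e; field; rewrite gt_eqF.
  by rewrite gerBl divr_ge0 ?sqr_ge0 // mulr_ge0 // ltW.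
exists (Num.min (c / 2) (e * s ^+ 2) / s).
  by rewrite divr_gt0 // lt_min divr_gt0 //= mulr_gt0 // exprn_gt0.
move=> p q; rewrite mulrAC ler_pdivrMr //.
have pp_ge0 := dot_ge0 p; have qq_ge0 := dot_ge0 q.
have := lP p; have := dot_ge0 (A *m p + s *: q).
have := dot_ge0 (2 *: (A *m p) + s *: q).
rewrite /primal_dual_form !(dotDl, dotDr, dotZl, dotZr) (dotC q (A *m p)).
set P := dot (A *m p) (A *m p); set B := dot (A *m p) q.
move: pp_ge0 qq_ge0; set pp := dot p p; set qq := dot q q.
move=> pp_ge0 qq_ge0 sq2_ge0 sq1_ge0 P_le.
have -> : (r * pp + t / s * P + 2 * B + s * qq) * s =
    c * pp + (1 - t) * (l * pp - P) + (P + 2 * s * B + s ^+ 2 * qq).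
  by rewrite /c; field; rewrite gt_eqF.
have tP : 0 <= (1 - t) * (l * pp - P) by rewrite mulr_ge0 ?subr_ge0.
set S := P + 2 * s * B + s ^+ 2 * qq.
have S_ge0 : 0 <= S by rewrite /S; lra.
have eS : 2 * e * S <= S by rewrite ler_piMl.
have : e * (s ^+ 2 * qq) <= e * (2 * S + 2 * P).
  by apply: ler_wpM2l; [exact: ltW|rewrite /S; lra].
have : 2 * e * P <= c / 2 * pp.
  apply: (@le_trans _ _ (2 * e * (l * pp))).
    by rewrite ler_wpM2l // mulr_ge0 // ltW.
  by rewrite mulrA ler_wpM2r.
have : Num.min (c / 2) (e * s ^+ 2) * pp <= c / 2 * pp.
  by rewrite ler_wpM2r // ge_min lexx.
have : Num.min (c / 2) (e * s ^+ 2) * qq <= e * s ^+ 2 * qq.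
  by rewrite ler_wpM2r // ge_min lexx orbT.
lra.
Qed.

Lemma cvg_primal_dual_form (T : Type) (F : set_system T) {FF : Filter F} A
    (r s t : R) (u : T -> 'cV[R]_n) (v : T -> 'cV[R]_m) p q :
  u @ F --> p -> v @ F --> q ->
  primal_dual_form A r s t (u x) (v x) @[x --> F] -->
    primal_dual_form A r s t p q.
Proof.
move=> up vq; have Aup : A *m u x @[x --> F] --> A *m p by exact: cvg_mulmx.
have cvgZdot (k : R) d (x y : T -> 'cV[R]_d) a b : x @ F --> a -> y @ F --> b ->
    k * dot (x i) (y i) @[i --> F] --> k * dot a b.
  by move=> xa yb; apply: cvgM; [exact: cvg_cst|exact: cvg_dot].
by apply: cvgD; [apply: cvgD; [apply: cvgD|]|]; exact: cvgZdot.
Qed.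

Lemma primal_dual_form0 A (r s t : R) : primal_dual_form A r s t 0 0 = 0.
Proof. by rewrite /primal_dual_form /dot !mulmx0 mxE !mulr0 !addr0. Qed.

(** With a, b the components of u^k - w, the second form is taken at u^{k+1} - w. The right side
    collects the bilinear terms left when the optimality conditions and the saddle inequalities are
    added. *)
Lemma primal_dual_form_descent A (r s alpha : R) (a p : 'cV[R]_n)
    (b q : 'cV[R]_m) :
  s != 0 ->
  primal_dual_form A r s (1 - alpha) a b
  - primal_dual_form A r s (1 - alpha) (a - p)
      (b - (q - ((1 - alpha) * s^-1) *: (A *m p)))
  - primal_dual_form A r s (alpha * (1 - alpha)) p q =
  2 * (- dot (A *m (p - a)) b - r * dot (p - a) p
       + dot (A *m (a - (1 + alpha) *: p)) (q - b) - s * dot (q - b) q).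
Proof.
move=> s_neq0.
rewrite /primal_dual_form !(mulmxDr, mulmxN) -!scalemxAr.
rewrite !(dotDl, dotDr, dotNl, dotNr, dotZl, dotZr).
move: (A *m a) (A *m p) => Aa Ap.
rewrite (dotC p a) (dotC q b) (dotC Ap Aa) (dotC b Ap) (dotC q Ap).
by field.
Qed.

End QuadraticForm.

(** * One iteration: variational form and descent towards saddle points *)

Section GCPPA.
Context {R : realType} {n m : nat}.
Context (X : set 'cV[R]_n) (Y : set 'cV[R]_m).
Context (f : 'cV[R]_n -> R) (g : 'cV[R]_m -> R) (A : 'M[R]_(m, n)).
Context (alpha r s : R).

(* Here p = x^k - x^{k+1} and q = y^k - ybar^{k+1}. *)
Definition gcppa_residual (u u' : 'cV[R]_n * 'cV[R]_m) (q : 'cV[R]_m) : Prop :=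
  let p := u.1 - u'.1 in
  [/\ X u'.1, Y (u.2 - q),
      u'.2 = u.2 - (q - ((1 - alpha) * s^-1) *: (A *m p)),
      forall x, X x ->
        f u'.1 <= f x - dot (A *m (x - u'.1)) u.2 - r * dot (x - u'.1) p &
      forall y, Y y ->
        g (u.2 - q) <= g y + dot (A *m (u.1 - (1 + alpha) *: p)) (y - (u.2 - q))
                       - s * dot (y - (u.2 - q)) q].

(** Each subproblem is a proximal minimization with linear term -A^T y^k, respectively A xbar. In
    the residual, ybar is u.2 - q and xbar is u.1 - (1 + alpha) p. *)
Lemma gcppa_step_residual u u' :
  convex_set X -> convex_set Y -> convex_function X f -> convex_function Y g ->
  gcppa_step X Y f g A alpha r s u u' -> exists q, gcppa_residual u u' q.
Proof.
move=> convX convY convf convg [ybar [[Xx x_min] [Yy y_max] u'2]].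
exists (u.2 - ybar); rewrite /gcppa_residual subKr.
set p := u.1 - u'.1.
have pN : u'.1 - u.1 = - p by rewrite /p opprB.
split => //.
- rewrite u'2 pN mulmxN; move: (A *m p) => Ap.
  by apply/colP => i; rewrite !mxE; ring.
- move=> x Xx'.
  have := @proximal_variational_inequality _ _ X f (- (A^T *m u.2)) u.1 u'.1 r
    convX convf _ x Xx'.
  rewrite pN !dotNr dotNl (dotC _ (x - _)) -dot_mulmxl mulrN; apply.
  split => // z Xz; have := x_min z Xz.
  rewrite /lagrangian !couplingE !sqr_enorm.
  rewrite dotNl (dotC _ u'.1) dotNl (dotC _ z).
  by rewrite -!dot_mulmxl !(dotC u.2); lra.
- move=> y Yy'.
  have xbarE : u'.1 + alpha *: (u'.1 - u.1) = u.1 - (1 + alpha) *: p.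
    by rewrite /p; apply/colP => i; rewrite !mxE; ring.
  rewrite xbarE in y_max.
  have := @proximal_variational_inequality _ _ Y g
    (A *m (u.1 - (1 + alpha) *: p)) u.2 ybar s convY convg _ y Yy'.
  rewrite -(opprB u.2 ybar) dotNr mulrN; apply.
  split => // z Yz; have := y_max z Yz.
  rewrite !couplingE !sqr_enorm !(dotC _ (A *m _)); lra.
Qed.

(** Adding the two optimality conditions at [w] to the two saddle inequalities cancels all values of
    f and g. What remains says that the right side of the descent identity is nonnegative. *)
Lemma gcppa_residual_fejer u u' q w :
  s != 0 -> saddle_point X Y f g A w -> gcppa_residual u u' q ->
  primal_dual_form A r s (1 - alpha) (u'.1 - w.1) (u'.2 - w.2)
  + primal_dual_form A r s (alpha * (1 - alpha)) (u.1 - u'.1) q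
  <= primal_dual_form A r s (1 - alpha) (u.1 - w.1) (u.2 - w.2).
Proof.
move=> s_neq0 [Xw Yw w_saddle] [Xx Yy u'2 x_opt y_opt].
have := x_opt _ Xw; have := y_opt _ Yw.
(* The saddle inequalities are tested at (x^{k+1}, ybar^{k+1}), since y^{k+1} may lie outside
   [Y]. *)
have [] := w_saddle _ _ Xx Yy.
rewrite /lagrangian !couplingE => w_max w_min y_le x_le.
set p := u.1 - u'.1 in y_le x_le u'2 *.
have xE : u'.1 - w.1 = (u.1 - w.1) - p.
  by rewrite /p; apply/colP => i; rewrite !mxE; ring.
have yE : u'.2 - w.2 = (u.2 - w.2) - (q - ((1 - alpha) * s^-1) *: (A *m p)).
  by rewrite u'2 addrAC.
have := @primal_dual_form_descent _ _ _ A r s alpha (u.1 - w.1) p (u.2 - w.2) q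
  s_neq0.
rewrite xE yE.
have -> : p - (u.1 - w.1) = w.1 - u'.1.
  by rewrite /p; apply/colP => i; rewrite !mxE; ring.
have -> : u.1 - w.1 - (1 + alpha) *: p = (u.1 - (1 + alpha) *: p) - w.1.
  by rewrite addrAC.
have -> : q - (u.2 - w.2) = w.2 - (u.2 - q).
  by apply/colP => i; rewrite !mxE; ring.
move: y_le x_le w_max w_min.
rewrite !(mulmxDr, mulmxN) !(dotDl, dotDr, dotNl, dotNr).
rewrite !(dotC w.2) !(dotC u.2) !(dotC q).
lra.
Qed.

End GCPPA.

(** * Limits of monotone sequences and passage to the limit in the residuals *)

Lemma nonincreasing_ge0_cvgn (R : realType) (v : nat -> R) :
  (forall k, 0 <= v k) -> (forall k, v k.+1 <= v k) -> cvgn v.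
Proof.
move=> v_ge0 v_le.
apply: nonincreasing_is_cvgn; first by apply/nonincreasing_seqP.
by exists 0 => _ [k _ <-].
Qed.

Lemma nonincreasing_diff_cvg0 (R : realType) (v : nat -> R) :
  (forall k, 0 <= v k) -> (forall k, v k.+1 <= v k) ->
  v k - v k.+1 @[k --> \oo] --> (0 : R).
Proof.
move=> v_ge0 v_le.
have /cvg_ex[/= l vl] := nonincreasing_ge0_cvgn v_ge0 v_le.
rewrite -(subrr l); apply: cvgB => //.
by have := vl; rewrite -cvg_shiftS.
Qed.

(** Monotonicity makes the whole sequence converge, and the subsequence identifies the limit. This
    is what upgrades subsequential convergence of the iterates. *)
Lemma nonincreasing_subseq_cvg0 (R : realType) (v : nat -> R) (h : nat -> nat) :
  (forall k, 0 <= v k) -> (forall k, v k.+1 <= v k) -> increasing_seq h ->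
  v (h k) @[k --> \oo] --> (0 : R) -> v @ \oo --> (0 : R).
Proof.
move=> v_ge0 v_le h_incr vh0.
have /cvg_ex[/= l vl] := nonincreasing_ge0_cvgn v_ge0 v_le.
suff -> : 0 = l by [].
apply: (cvg_unique _ vh0) => //.
exact: (@cvg_comp _ _ _ h v _ _ _ (increasing_seq_cvg_infty h_incr) vl).
Qed.

Lemma coercive_cvg0 (R : realType) n m (E : 'cV[R]_n -> 'cV[R]_m -> R) (d : R)
    (p : nat -> 'cV[R]_n) (q : nat -> 'cV[R]_m) :
  0 < d -> (forall a b, d * (dot a a + dot b b) <= E a b) ->
  E (p k) (q k) @[k --> \oo] --> (0 : R) ->
  p @ \oo --> (0 : 'cV[R]_n) /\ q @ \oo --> (0 : 'cV[R]_m).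
Proof.
move=> d_gt0 dE E0.
have Ed0 : E (p k) (q k) / d @[k --> \oo] --> (0 : R).
  by rewrite -(mul0r d^-1); apply: cvgM => //; exact: cvg_cst.
have le_Ed a b : dot a a + dot b b <= E a b / d by rewrite ler_pdivlMr // mulrC.
split; apply: cvg_dot0; apply: (squeeze_cvgr _ (cvg_cst 0) Ed0);
  apply: nearW => k; rewrite dot_ge0 /=; apply: le_trans (le_Ed _ _).
- by rewrite lerDl dot_ge0.
- by rewrite lerDr dot_ge0.
Qed.

Lemma subr_cvg (R : realType) n (a b : nat -> 'cV[R]_n) (x : 'cV[R]_n) :
  a @ \oo --> x -> b @ \oo --> (0 : 'cV[R]_n) -> a k - b k @[k --> \oo] --> x.
Proof. by move=> ax b0; rewrite -(subr0 x); exact: cvgB. Qed.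

Lemma cvg_addr_cst (R : realType) n (a : nat -> 'cV[R]_n) (b c : 'cV[R]_n) :
  a k - c @[k --> \oo] --> b -> a @ \oo --> b + c.
Proof.
move=> ab; have aE k : a k = a k - c + c by rewrite subrK.
by under eq_cvg do rewrite aE; apply: cvgD ab _; exact: cvg_cst.
Qed.

(** As p and q vanish, x^{k+1}, ybar^{k+1} and xbar^{k+1} share the limits of the iterates. The
    variational inequalities pass to the limit, by semicontinuity on the left and continuity on the
    right, and lose their proximal terms. *)
Lemma residual_limit_saddle (R : realType) (n m : nat)
  (X : set 'cV[R]_n) (Y : set 'cV[R]_m)
  (f : 'cV[R]_n -> R) (g : 'cV[R]_m -> R) (A : 'M[R]_(m, n))
  (alpha r s : R) (u u' : nat -> 'cV[R]_n * 'cV[R]_m) (q : nat -> 'cV[R]_m)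
  (x : 'cV[R]_n) (y : 'cV[R]_m) :
  closed X -> closed Y ->
  lower_semicontinuous (extend_pinfty X f) ->
  lower_semicontinuous (extend_pinfty Y g) ->
  (forall k, gcppa_residual X Y f g A alpha r s (u k) (u' k) (q k)) ->
  (u k).1 @[k --> \oo] --> x -> (u k).2 @[k --> \oo] --> y ->
  (u k).1 - (u' k).1 @[k --> \oo] --> (0 : 'cV[R]_n) ->
  q @ \oo --> (0 : 'cV[R]_m) ->
  saddle_point X Y f g A (x, y).
Proof.
move=> clX clY lscf lscg res ux uy p0 q0.
have dot0r k (z : 'cV[R]_k) : dot z 0 = 0 by rewrite /dot mulmx0 mxE.
have u'x : (u' k).1 @[k --> \oo] --> x.
  have u'E k : (u' k).1 = (u k).1 - ((u k).1 - (u' k).1) by rewrite subKr.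
  by under eq_cvg do rewrite u'E; exact: subr_cvg.
have ybar : (u k).2 - q k @[k --> \oo] --> y by exact: subr_cvg.
have cvgcB d (z b : 'cV[R]_d) (a : nat -> 'cV[R]_d) :
    a @ \oo --> b -> z - a k @[k --> \oo] --> z - b.
  by move=> ab; apply: cvgB => //; exact: cvg_cst.
have Xx : X x.
  apply: (@closed_cvg _ _ \oo _ (fun k => (u' k).1) X clX _ _ u'x).
  by apply: nearW => k; have [] := res k.
have Yy : Y y.
  apply: (@closed_cvg _ _ \oo _ (fun k => (u k).2 - q k) Y clY _ _ ybar).
  by apply: nearW => k; have [] := res k.
split => // z w Xz Yw /=; rewrite /lagrangian !couplingE; split.
(* The factor 0 is the limit of q; it is kept so that the bound is the literal limit of the right
   sides. *)
- have : g y <= g w + dot (A *m x) (w - y) - s * dot (w - y) 0.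
    apply: (@lsc_extend_limit _ _ Y g (fun k => (u k).2 - q k) y (fun k =>
      g w + dot (A *m ((u k).1 - (1 + alpha) *: ((u k).1 - (u' k).1)))
                (w - ((u k).2 - q k))
      - s * dot (w - ((u k).2 - q k)) (q k)) _ clY lscg) => //.
    + by move=> k; have [] := res k.
    + by move=> k; have [_ _ _ _ y_opt] := res k; exact: y_opt.
    + apply: cvgB; first apply: cvgD; first exact: cvg_cst.
        apply: cvg_dot; last exact: cvgcB.
        apply: cvg_mulmx; apply: subr_cvg => //.
        rewrite -(scaler0 _ (1 + alpha)); exact: cvgZr.
      by apply: cvgM; [exact: cvg_cst|apply: cvg_dot => //; exact: cvgcB].
  by rewrite dot0r mulr0 subr0 dotDr dotNr !(dotC _ (A *m x)); lra.
- have : f x <= f z - dot (A *m (z - x)) y - r * dot (z - x) 0.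
    apply: (@lsc_extend_limit _ _ X f (fun k => (u' k).1) x (fun k =>
      f z - dot (A *m (z - (u' k).1)) (u k).2
      - r * dot (z - (u' k).1) ((u k).1 - (u' k).1)) _ clX lscf) => //.
    + by move=> k; have [] := res k.
    + by move=> k; have [_ _ _ x_opt _] := res k; exact: x_opt.
    + apply: cvgB; first apply: cvgB; first exact: cvg_cst.
        by apply: cvg_dot => //; apply: cvg_mulmx; exact: cvgcB.
      by apply: cvgM; [exact: cvg_cst|apply: cvg_dot => //; exact: cvgcB].
  by rewrite dot0r mulr0 subr0 mulmxDr mulmxN dotDl dotNl !(dotC y); lra.
Qed.

(** * Convergence of the iterates to a saddle point *)

Theorem theorem4p2 (R : realType) (n m : nat)
  (X : set 'cV[R]_n) (Y : set 'cV[R]_m)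
  (f : 'cV[R]_n -> R) (g : 'cV[R]_m -> R) (A : 'M[R]_(m, n))
  (closedX : closed X) (convexX : convex_set X)
  (closedY : closed Y) (convexY : convex_set Y)
  (proper_convex_f : proper_convex X f)
  (proper_convex_g : proper_convex Y g)
  (lsc_f : lower_semicontinuous (extend_pinfty X f))
  (lsc_g : lower_semicontinuous (extend_pinfty Y g))
  (solvable : exists u, saddle_point X Y f g A u)
  (alpha r s : R) (alpha_ge0 : 0 <= alpha) (alpha_le1 : alpha <= 1)
  (r_gt0 : 0 < r) (s_gt0 : 0 < s)
  (rs_large : (1 - alpha + alpha ^+ 2) * largest_eigenvalue (A^T *m A) < r * s)
  (u : nat -> 'cV[R]_n * 'cV[R]_m)
  (gen_u : gcppa_sequence X Y f g A alpha r s u) :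
  exists2 ustar, saddle_point X Y f g A ustar & u @ \oo --> ustar.
Proof.
have [_ convf] := proper_convex_f; have [_ convg] := proper_convex_g.
have [w w_saddle] := solvable.
have [q res] := choice (fun k => gcppa_step_residual convexX convexY convf convg
  (gen_u k)).
have [rho_ge0 _] := largest_eigenvalue_gram A.
have s_neq0 : s != 0 by rewrite gt_eqF.
have [||dH dH_gt0 dHP] :=
    @primal_dual_form_coercive _ _ _ A r s (1 - alpha) s_gt0.
- by rewrite gerBl.
- apply: le_lt_trans rs_large; rewrite ler_wpM2r // subKr.
  by have := sqr_ge0 (1 - alpha); lra.
(* Here 1 - t = 1 - alpha + alpha^2, so coercivity is exactly the assumption on r s. *)
have [||dG dG_gt0 dGP] :=
    @primal_dual_form_coercive _ _ _ A r s (alpha * (1 - alpha)) s_gt0.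
- by have := sqr_ge0 (1 - alpha); nra.
- by rewrite (_ : 1 - _ = 1 - alpha + alpha ^+ 2) //; ring.
pose H := primal_dual_form A r s (1 - alpha).
pose G := primal_dual_form A r s (alpha * (1 - alpha)).
(* The squared H-distance from u^k to [z]. It serves first with the given solution [w], then with
   the cluster point. *)
pose V z k := H ((u k).1 - z.1) ((u k).2 - z.2).
pose p k := (u k).1 - (u k.+1).1.
have form_ge0 d (E : 'cV[R]_n -> 'cV[R]_m -> R) a b : 0 < d ->
    d * (dot a a + dot b b) <= E a b -> 0 <= E a b.
  by move=> d_gt0; apply: le_trans; rewrite mulr_ge0 ?addr_ge0 ?dot_ge0 // ltW.
have V_ge0 z k : 0 <= V z k by exact: form_ge0 dH_gt0 (dHP _ _).
have G_ge0 k : 0 <= G (p k) (q k) by exact: form_ge0 dG_gt0 (dGP _ _).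
have V_descent z k : saddle_point X Y f g A z ->
    V z k.+1 + G (p k) (q k) <= V z k.
  by move=> z_saddle; exact: gcppa_residual_fejer s_neq0 z_saddle (res k).
have V_le z k : saddle_point X Y f g A z -> V z k.+1 <= V z k.
  by move=> /(V_descent z k); apply: le_trans; rewrite lerDl.
have [p0 q0] : p @ \oo --> (0 : 'cV[R]_n) /\ q @ \oo --> (0 : 'cV[R]_m).
  apply: (coercive_cvg0 dG_gt0 dGP).
  (* G(p, q) is squeezed between 0 and the decrease of V, and consecutive differences of a
     convergent sequence tend to 0. *)
  have dV0 :=
    @nonincreasing_diff_cvg0 R (V w) (V_ge0 w) (fun k => V_le w k w_saddle).
  apply: (squeeze_cvgr _ (cvg_cst 0) dV0); apply: nearW => k.
  by rewrite G_ge0 /= lerBrDl; exact: V_descent.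
have V_bound k : dot ((u k).1 - w.1) ((u k).1 - w.1)
    + dot ((u k).2 - w.2) ((u k).2 - w.2) <= V w 0 / dH.
  rewrite ler_pdivlMr // mulrC; apply: le_trans (dHP _ _) _.
  by elim: k => // k; apply: le_trans; exact: V_le.
have [|h1 h1_incr [a ua]] :=
    @bounded_cV_cvg_subseq R n (fun k => (u k).1 - w.1) (V w 0 / dH).
  by move=> k; apply: le_trans (V_bound k); rewrite lerDl dot_ge0.
(* The second extraction runs along [h1], so that both components converge along the composite
   [h]. *)
have [|h2 h2_incr [b ub]] :=
    @bounded_cV_cvg_subseq R m (fun k => (u (h1 k)).2 - w.2) (V w 0 / dH).
  by move=> k; apply: le_trans (V_bound (h1 k)); rewrite lerDr dot_ge0.
pose h k := h1 (h2 k).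
have h_incr : increasing_seq h.
  by move=> i j; exact: etrans (h1_incr _ _) (h2_incr _ _).
have h_oo := increasing_seq_cvg_infty h_incr.
have {}ua : (u (h k)).1 - w.1 @[k --> \oo] --> a.
  exact: (@cvg_comp _ _ _ h2 (fun k => (u (h1 k)).1 - w.1) _ _ _
    (increasing_seq_cvg_infty h2_incr) ua).
pose xs := a + w.1; pose ys := b + w.2.
have uhx : (u (h k)).1 @[k --> \oo] --> xs.
  exact: (@cvg_addr_cst _ _ (fun k => (u (h k)).1)).
have uhy : (u (h k)).2 @[k --> \oo] --> ys.
  exact: (@cvg_addr_cst _ _ (fun k => (u (h k)).2)).
have us_saddle : saddle_point X Y f g A (xs, ys).
  apply: (residual_limit_saddle closedX closedY lsc_f lsc_g
    (fun k => res (h k)) uhx uhy).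
  - exact: (@cvg_comp _ _ _ h p _ _ _ h_oo p0).
  - exact: (@cvg_comp _ _ _ h q _ _ _ h_oo q0).
(* The cluster point is itself a saddle point, so the distance to it is nonincreasing; it tends to 0
   along [h], hence along the whole sequence. *)
have V0 : V (xs, ys) @ \oo --> (0 : R).
  apply: (nonincreasing_subseq_cvg0 (V_ge0 _)
    (fun k => V_le _ k us_saddle) h_incr).
  rewrite -(primal_dual_form0 A r s (1 - alpha)).
  by apply: cvg_primal_dual_form; rewrite -(subrr xs, subrr ys);
    apply: cvgB => //; exact: cvg_cst.
have [ux uy] := coercive_cvg0 dH_gt0 dHP V0.
exists (xs, ys) => //.
have -> : u = fun k => ((u k).1, (u k).2) by apply/funext => k; case: (u k).
apply: (@cvg_pair _ _ _ \oo (nbhs xs) (nbhs ys) _ _ _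
  (fun k => (u k).1) (fun k => (u k).2)).
- by rewrite -[xs]add0r; exact: (@cvg_addr_cst _ _ (fun k => (u k).1)).
- by rewrite -[ys]add0r; exact: (@cvg_addr_cst _ _ (fun k => (u k).2)).
Qed.
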